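(* The diameter of a random Cayley digraph of order $n$ and degree $k$ is asymptotically almost surely equal to two, provided that $k/n$ remains in a compact subset of the interval $(0,1/2)$ as $n\to\infty$; furthermore, the convergence is exponentially fast. That is, for every compact set $K\subset(0,1/2)$ there exist constants $C>0$ and $\delta>0$ (depending only on $K$) such that for all positive integers $n,k$ with $k/n\in K$ and every group $G$ of order $n$, if $S$ is a uniformly random $k$-element subset of $G\setminus\{1\}$, then $$\Pr\big(\operatorname{diam}(\operatorname{Cay}(G,S))\neq 2\big)\le C e^{-\delta n}.$$
   Context: For a finite group $G$ and a subset $S\subseteq G\setminus\{1\}$, the Cayley digraph $\operatorname{Cay}(G,S)$ has vertex set $G$ and arc set $\{(g,gs): g\in G, s\in S\}$. The distance from $g$ to $h$ is the length of the shortest directed path from $g$ to $h$ (infinite if there is none). The diameter $\operatorname{diam}(\operatorname{Cay}(G,S))$ is the smallest integer $d$ such that for every ordered pair $(g,h)$ the distance from $g$ to $h$ is at most $d$ (and is $\infty$ if no such $d$ exists). A random Cayley digraph of order $n$ and degree $k$, $1\le k\le n-1$, is $\operatorname{Cay}(G,S)$ where $G$ is an arbitrary group of order $n$ and $S$ is chosen uniformly among all $k$-element subsets of $G\setminus\{1\}$. *)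

(* Defs.v *)
From HB Require Import structures.
From mathcomp Require Import all_boot all_order all_algebra all_fingroup.
From mathcomp Require Import all_classical all_reals all_analysis.

Set Implicit Arguments.
Unset Strict Implicit.
Unset Printing Implicit Defensive.

Import Order.TTheory GRing.Theory Num.Theory.
Import numFieldNormedType.Exports.

(* The least natural number satisfying P, or None (read: infinity) if there is
   no such number. *)
Definition least (P : pred nat) : option nat :=
  if pselect (exists n, P n) is left exP then Some (ex_minn exP) else None.

Section Digraph.
Variables (T : finType) (arc : rel T).

Definition dipath_of_length (x y : T) (n : nat) : bool :=
  [exists p : n.-tuple T, [&& path arc x p, uniq (x :: p) & last x p == y]].

Definition distance (x y : T) : option nat := least (dipath_of_length x y).

Definition distance_at_most (x y : T) (d : nat) : bool :=
  if distance x y is Some m then m <= d else false.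

Definition diameter : option nat :=
  least (fun d => [forall x, forall y, distance_at_most x y d]).

End Digraph.

(* Arc relation of Cay(G, S), for G the full group of elements of gT. *)
Definition Cay (gT : finGroupType) (S : {set gT}) : rel gT :=
  fun g h => [exists s in S, h == (g * s)%g].

Definition connection_sets (gT : finGroupType) (k : nat) : {set {set gT}} :=
  [set S : {set gT} | (S \subset [set~ 1%g]) && (#|S| == k)].

(* Probability of the event E for a uniformly random element of A; it is only
   meaningful for A nonempty. *)
Definition uniform_Pr (R : realType) (T : finType) (A : {set T}) (E : pred T) : R :=
  (#|[set x in A | E x]|%:R / #|A|%:R)%R.

(* Main.v *)
Require Import Defs.
From HB Require Import structures.
From mathcomp Require Import all_boot all_order all_algebra all_fingroup.
From mathcomp Require Import all_classical all_reals all_analysis.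
From mathcomp Require Import zify ring lra.
Import Order.TTheory GRing.Theory Num.Theory.
Import numFieldNormedType.Exports.
Local Open Scope ring_scope.

(** If the products [s * t] with [s, t] in [S] exhaust the group, then the
diameter is at most two, and it is at least two because [2k < n].  Fix [x] and
draw every element independently with probability [p = k/n].  The pairs
[{s, s^-1 x}] are the edges of the functional graph of a permutation, so each
meets at most two others and a third of them can be chosen disjoint; hence no
pair lies in [S] with probability at most [(1 - p^2)^(n/3)].  As [k] is the mode
of the binomial law, conditioning on [#|S| = k] costs a factor [n + 1];
conditioning on [1 \notin S] costs a factor [2], and the union bound over [x] a
factor [n]. *)

(** * Directed distance and Cayley digraphs of diameter two *)

Lemma leastP (P : pred nat) (n : nat) :
  P n -> (forall m, P m -> (n <= m)%N) -> least P = Some n.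
Proof.
move=> Pn minn; rewrite /least; case: pselect => [exP|[]]; last by exists n.
case: ex_minnP => m Pm le_m; congr Some; apply/eqP.
by rewrite eqn_leq le_m ?minn.
Qed.

Lemma distance_at_mostP (T : finType) (arc : rel T) (x y : T) (d : nat) :
  reflect (exists2 m, (m <= d)%N & dipath_of_length arc x y m)
    (distance_at_most arc x y d).
Proof.
rewrite /distance_at_most /distance /least.
case: pselect => [exP|noP]; last by right => -[m _ Pm]; apply: noP; exists m.
case: ex_minnP => m Pm le_m; apply: (iffP idP) => [md|[j jd Pj]]; first by exists m.
exact: leq_trans (le_m _ Pj) jd.
Qed.

Lemma distance_at_most1 (T : finType) (arc : rel T) (x y : T) :
  distance_at_most arc x y 1 -> (x == y) || arc x y.
Proof.
case/distance_at_mostP => -[|[|//]] _ /existsP [p /and3P [+ _]].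
  by rewrite tuple0 /= => _ ->.
case/tupleP: p => z p; rewrite tuple0 /= andbT => axz /eqP <-.
by rewrite axz orbT.
Qed.

Lemma mem_Cay (gT : finGroupType) (S : {set gT}) (g h : gT) :
  Cay S g h = ((g^-1 * h)%g \in S).
Proof.
apply/existsP/idP => [[s /andP [sS /eqP ->]]|hS]; first by rewrite mulKg.
by exists (g^-1 * h)%g; rewrite hS mulKVg eqxx.
Qed.

Lemma diameter_Cay_eq2 (gT : finGroupType) (S : {set gT}) :
  1%g \notin S -> (#|S|.+1 < #|gT|)%N ->
  (forall x, exists s, (s \in S) && ((s^-1 * x)%g \in S)) ->
  diameter (Cay S) = Some 2%N.
Proof.
move=> S1 ltS SS; apply: leastP.
  apply/forallP => g; apply/forallP => h; apply/distance_at_mostP.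
  (* Paths are repetition-free, so the walk [g], [g * s], [h] is usable only once the cases [g = h]
     and [g^-1 * h \in S] are set aside. *)
  have [<-|gh] := eqVneq g h.
    by exists 0%N => //; apply/existsP; exists [tuple]; rewrite /= eqxx.
  have [ghS|ghS] := boolP ((g^-1 * h)%g \in S).
    exists 1%N => //; apply/existsP; exists [tuple h].
    by rewrite /= mem_Cay ghS inE gh eqxx.
  have [s /andP [sS tS]] := SS (g^-1 * h)%g.
  exists 2%N => //; apply/existsP; exists [tuple (g * s)%g; h].
  rewrite /= !mem_Cay mulKg sS invMg -mulgA tS !inE !eqxx (negbTE gh) orbF /= andbT.
  apply/andP; split.
    by apply/eqP => /(canLR (mulKg g)); rewrite mulVg => s1; rewrite s1 sS in S1.
  by rewrite andbT; apply/eqP => gsh; rewrite -gsh mulKg sS in ghS.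
(* By cardinality some [x] is neither [1] nor in [S]; no path of length at most one joins [1] to
   it. *)
have [x] : exists x, x \notin 1%g |: S.
  apply/existsP; rewrite -negb_forall; apply: contraL ltS => /forallP all1S.
  rewrite -leqNgt -add1n; apply: leq_trans (_ : #|1%g |: S| <= _)%N.
    by apply/subset_leq_card/fintype.subsetP => y _; exact: all1S.
  by rewrite cardsU1 leq_add2r leq_b1.
rewrite !inE negb_or => /andP [x1 xS] m /forallP /(_ 1%g) /forallP /(_ x).
rewrite leqNgt ltnS => /distance_at_mostP [j jm Pj]; apply/negP => m1.
have : distance_at_most (Cay S) 1%g x 1.
  by apply/distance_at_mostP; exists j => //; exact: leq_trans jm m1.
by move/distance_at_most1; rewrite mem_Cay invg1 mul1g eq_sym (negbTE x1) (negbTE xS).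
Qed.

(** * Subsets drawn by independent trials of parameter [p] *)

Section BernoulliSubset.
Variables (R : realFieldType) (T : finType) (p : R).
Hypothesis p01 : 0 <= p <= 1.

Definition bernoulli_weight (S : {set T}) : R := p ^+ #|S| * (1 - p) ^+ #|~: S|.

Definition bernoulli_Pr (F : pred {set T}) : R :=
  \sum_(S | F S) bernoulli_weight S.

Lemma bernoulli_weight_ge0 S : 0 <= bernoulli_weight S.
Proof. by case/andP: p01 => p0 p1; apply: mulr_ge0; apply: exprn_ge0; rewrite ?subr_ge0. Qed.

Lemma bernoulli_Pr_le (F H : pred {set T}) :
  (forall S, F S -> H S) -> bernoulli_Pr F <= bernoulli_Pr H.
Proof.
move=> FH; rewrite /bernoulli_Pr [leRHS](bigID F) /=.
rewrite (eq_bigl F) => [|S]; last by apply/andP/idP => [[]//|FS]; rewrite FH.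
by rewrite lerDl sumr_ge0 // => S _; exact: bernoulli_weight_ge0.
Qed.

(** Grouping the sets by cardinality gives the binomial expansion of [(1 - p + p) ^+ #|T|]. *)
Lemma bernoulli_PrT : bernoulli_Pr predT = 1.
Proof.
rewrite /bernoulli_Pr -[RHS](expr1n R #|T|) -[in RHS](subrK p 1) exprDn.
rewrite (partition_big (fun S : {set T} => inord #|S| : 'I_#|T|.+1) predT) //=.
apply: eq_bigr => i _.
rewrite (eq_bigr (fun=> (1 - p) ^+ (#|T| - i) * p ^+ i)) => [|S /eqP <-].
  rewrite sumr_const -(card_draws T i); congr (_ *+ _); apply: eq_card => S.
  by rewrite unfold_in /= inE inordK // ltnS max_card.
rewrite inordK ?ltnS ?max_card // /bernoulli_weight mulrC; congr (_ ^+ _ * _).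
by rewrite -(cardsC S) addKn.
Qed.

(* [F] does not depend on whether [u] is selected, so it is independent of the
   event [u \in S]. *)
Lemma bernoulli_Pr_mem (F : pred {set T}) (u : T) :
  (forall S, F (u |: S) = F (S :\ u)) ->
  bernoulli_Pr (fun S => F S && (u \in S)) = p * bernoulli_Pr F.
Proof.
move=> Fu; rewrite {2}/bernoulli_Pr (bigID (fun S : {set T} => u \in S)) /=.
rewrite -/(bernoulli_Pr (fun S => F S && (u \in S))).
set X := bernoulli_Pr _; set Y := (X in _ = p * (_ + X)).
(* Adding [u] to a set trades a factor [1 - p] for a factor [p], and [F] does not notice. *)
suff qX : (1 - p) * X = p * Y by rewrite mulrDr -qX; ring.
rewrite /X /bernoulli_Pr (reindex_onto (fun S => u |: S) (fun S => S :\ u)) /=; last first.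
  by move=> S /andP [_ uS]; rewrite finset.setD1K.
rewrite /Y !mulr_sumr; apply: eq_big => [S|S].
  rewrite finset.setU11 andbT; have [uS|uS] := boolP (u \in S).
    rewrite andbF; apply/negP => /andP [_ /eqP eS]; move: uS.
    by rewrite -eS !inE eqxx.
  by rewrite finset.setU1K // eqxx !andbT Fu (finset.setDidPl _) // disjoint_sym disjoints1.
move=> /andP [_ /eqP eS]; have uS : u \notin S by rewrite -eS !inE eqxx.
have eC : ~: S = u |: ~: (u |: S).
  by apply/setP => v; rewrite !inE; have [->|] := eqVneq v u; rewrite ?uS.
rewrite /bernoulli_weight eC !cardsU1 uS !inE eqxx /= !add1n !exprS; ring.
Qed.

(** Only edges starting in [U] count, so that an induction can shrink [U]; loops [f s = s] are
    allowed. *)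
Definition contains_no_edge (f : T -> T) (U : {set T}) (S : {set T}) : bool :=
  [forall s in U, ~~ ((s \in S) && (f s \in S))].

(* Removing from [U] one edge [{s, f s}] and the at most two edges of [U]
   meeting it leaves an event that does not depend on [s] and [f s]. *)
Lemma bernoulli_Pr_contains_no_edge (f : T -> T) (c : R) (U : {set T}) :
  injective f -> 0 <= c <= 1 -> 1 - p ^+ 2 <= c ^+ 3 ->
  bernoulli_Pr (contains_no_edge f U) <= c ^+ #|U|.
Proof.
move=> f_inj /andP [c0 c1] pc; have /andP [p0 p1] := p01; have [m] := ubnP #|U|; elim: m U => // m IHm U ltUm.
have [->|[s sU]] := set_0Vmem U.
  by rewrite cards0 expr0 -bernoulli_PrT; exact: bernoulli_Pr_le.
pose B := [set s; f s].
pose U' := [set t in U | (t \notin B) && (f t \notin B)].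
have cardU : (#|U| <= 3 + #|U'|)%N.
  (* A starting point [t] is lost when [t] or [f t] is [s] or [f s]; by injectivity this leaves [s],
     [f s] and at most one preimage of [s]. *)
  rewrite -(cardsID (s |: (f s |: f @^-1: pred1 s)) U) leq_add //.
    apply: leq_trans (subset_leq_card (subsetIr _ _)) _.
    rewrite cardsU1 (leq_add (leq_b1 _)) // cardsU1 (leq_add (leq_b1 _)) //.
    rewrite -(card_imset _ f_inj) -(cards1 s); apply: subset_leq_card.
    by apply/fintype.subsetP => _ /imsetP [t + ->]; rewrite !inE.
  apply/subset_leq_card/fintype.subsetP => t; rewrite !inE !negb_or.
  by move=> /andP [/and3P [ts -> ->] ->]; rewrite (inj_eq f_inj) ts.
have ltU' : (#|U'| < m)%N.
  apply: leq_trans (ltUm : #|U| <= m)%N; apply: proper_card.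
  apply/properP; split; first by apply/fintype.subsetP => t; rewrite inE => /andP[].
  by exists s; rewrite // !inE eqxx andbF.
set F' := contains_no_edge f U'.
have F'E (S1 S2 : {set T}) : (forall t, t \notin B -> (t \in S1) = (t \in S2)) -> F' S1 = F' S2.
  move=> S12; apply: eq_forallb => t; rewrite !inE.
  case: (boolP [&& _, _ & _]) => //= /and3P [_ tB ftB].
  by rewrite !S12 // ?inE.
have F'in u (S : {set T}) : u \in B -> F' (u |: S) = F' (S :\ u).
  move=> uB; apply: F'E => t tB; rewrite !inE.
  by have -> : t == u = false by apply: contraNF tB => /eqP ->.
have p2 : p ^+ 2 * bernoulli_Pr F' <=
    bernoulli_Pr (fun S => F' S && ((s \in S) && (f s \in S))).
  have F's (S : {set T}) : F' (s |: S) = F' (S :\ s) by apply: F'in; rewrite !inE eqxx.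
  (* A loop lies in [S] with probability [p], which is at least [p ^+ 2]. *)
  have [es|nes] := eqVneq (f s) s.
    rewrite es; have -> : (fun S : {set T} => F' S && ((s \in S) && (s \in S))) =
        (fun S => F' S && (s \in S)) by apply/funext => S; rewrite andbb.
    rewrite bernoulli_Pr_mem // ler_wpM2r //; last by rewrite expr2 ler_piMr.
    by apply: sumr_ge0 => S _; exact: bernoulli_weight_ge0.
  have -> : (fun S : {set T} => F' S && ((s \in S) && (f s \in S))) =
      (fun S => (F' S && (s \in S)) && (f s \in S)).
    by apply/funext => S; rewrite andbA.
  rewrite (bernoulli_Pr_mem (fun S => F' S && (s \in S))) => [|S].
    by rewrite bernoulli_Pr_mem // expr2 mulrA.
  by rewrite F'in ?inE ?eqxx ?orbT // [s == f s]eq_sym (negbTE nes).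
have split_F' : bernoulli_Pr (contains_no_edge f U) +
    bernoulli_Pr (fun S => F' S && ((s \in S) && (f s \in S))) <= bernoulli_Pr F'.
  rewrite [leRHS](bigID (fun S : {set T} => (s \in S) && (f s \in S))) /=.
  rewrite [leLHS]addrC; apply: lerD => //; apply: bernoulli_Pr_le => S /forallP noS.
  rewrite (implyP (noS s)) // andbT; apply/forallP => t; rewrite inE.
  by apply/implyP => /andP [tU _]; exact: implyP (noS t) tU.
apply: (@le_trans _ _ ((1 - p ^+ 2) * bernoulli_Pr F')).
  by rewrite mulrBl mul1r; lra.
(* Here [c] acts as a cube root of [1 - p ^+ 2]: each chosen edge uses up at most three elements of
   [U]. *)
apply: (@le_trans _ _ (c ^+ (3 + #|U'|))).
  rewrite exprD; apply: ler_pM => //; last exact: IHm.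
    nra.
  by apply: sumr_ge0 => S _; exact: bernoulli_weight_ge0.
by apply: ler_wiXn2l; rewrite ?cardU //; lra.
Qed.

(** All sets of size [k] have the same weight, so a bound on the probability of [F] bounds their
    number in [F]. *)
Lemma card_bernoulli_Pr (F : pred {set T}) (k : nat) :
  #|[set S : {set T} | (#|S| == k) && F S]|%:R * (p ^+ k * (1 - p) ^+ (#|T| - k))
    <= bernoulli_Pr F.
Proof.
apply: (@le_trans _ _ (bernoulli_Pr (fun S => (#|S| == k) && F S))); last first.
  by apply: bernoulli_Pr_le => S /andP[].
rewrite /bernoulli_Pr (eq_bigr (fun=> p ^+ k * (1 - p) ^+ (#|T| - k))).
  rewrite sumr_const mulr_natl le_eqVlt; apply/orP; left; apply/eqP.
  by congr (_ *+ _); apply: eq_card => S; rewrite inE.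
move=> S /andP [/eqP <- _]; rewrite /bernoulli_weight; congr (_ * _ ^+ _).
by rewrite -(cardsC S) addKn.
Qed.

End BernoulliSubset.

(** * The binomial law at its mode *)

Lemma binomial_mode (n k j : nat) : (k < n)%N -> (j <= n)%N ->
  ('C(n, j) * (k ^ j * (n - k) ^ (n - j)) <=
   'C(n, k) * (k ^ k * (n - k) ^ (n - k)))%N.
Proof.
move=> kn jn; pose f i := ('C(n, i) * (k ^ i * (n - k) ^ (n - i)))%N.
rewrite -/(f j) -/(f k).
(* [f] is the binomial law of parameter [k / n] scaled by [n ^ n]. Its successive ratios
   [(n - i) * k / (i.+1 * (n - k))] are at least one for [i < k] and at most one for [i >= k]. *)
have step i : (i < n)%N -> (f i.+1 * (i.+1 * (n - k)) = f i * ((n - i) * k))%N.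
  move=> ltin; rewrite /f -(subnSK ltin) !expnS.
  move: (mul_bin_left n i); rewrite -(subnSK ltin).
  set a := 'C(n, i.+1); set b := 'C(n, i); set x := (k ^ i)%N.
  set y := ((n - k) ^ _)%N => ab.
  transitivity ((i.+1 * a) * (k * x * y * (n - k)))%N; first by ring.
  by rewrite ab; ring.
have [jk|/ltnW kj] := leqP j k.
  rewrite -(subKn jk); move: (k - j)%N (leq_subr j k) => d.
  elim: d => [|d IHd] dk; first by rewrite subn0.
  apply: leq_trans (IHd (ltnW dk)); move: (step (k - d.+1)%N).
  rewrite subnSK // => /(_ ltac:(lia)) e.
  have pos : (0 < (n - (k - d.+1)) * k)%N by rewrite muln_gt0; lia.
  by rewrite -(leq_pmul2r pos) -e leq_mul2l; apply/orP; right; nia.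
rewrite -(subnKC kj) in jn *; move: (j - k)%N jn => d.
elim: d => [|d IHd] dn; first by rewrite addn0.
have dn' : (k + d < n)%N by lia.
apply: leq_trans (IHd (ltnW dn')); rewrite addnS.
have pos : (0 < (k + d).+1 * (n - k))%N by rewrite muln_gt0; lia.
by rewrite -(leq_pmul2r pos) step // leq_mul2l; apply/orP; right; nia.
Qed.

(** The [n.+1] binomial probabilities sum to one and the largest is the one at [k]. *)
Lemma binomial_mode_ge (R : realFieldType) (n k : nat) : (k < n)%N ->
  let p : R := k%:R / n%:R in
  1 <= n.+1%:R * 'C(n, k)%:R * (p ^+ k * (1 - p) ^+ (n - k)).
Proof.
move=> kn; rewrite /=; set p := _ / _; have n0 : 0 < n%:R :> R by rewrite ltr0n; lia.
have -> : 1 - p = (n - k)%:R / n%:R.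
  by rewrite natrB ?(ltnW kn) // /p; field; exact: lt0r_neq0.
rewrite !expr_div_n mulf_div -exprD subnKC ?(ltnW kn) // mulrA.
rewrite ler_pdivlMr ?exprn_gt0 // mul1r -!natrX -!natrM ler_nat.
rewrite -{1}(subnK (ltnW kn)) expnDn -mulnA.
rewrite -[n.+1 in leqRHS]card_ord -sum_nat_const; apply: leq_sum => i _.
by rewrite (mulnC (_ ^ (n - i))%N) binomial_mode // -ltnS.
Qed.

(** * Transfer to sets of size [k], and the union bound *)

Lemma card_contains_no_edge (R : realFieldType) (T : finType) (f : T -> T)
    (k : nat) (c : R) :
  let p : R := k%:R / #|T|%:R in
  injective f -> (k < #|T|)%N -> 0 <= c <= 1 -> 1 - p ^+ 2 <= c ^+ 3 ->
  #|[set S : {set T} | (#|S| == k) && contains_no_edge T f [set: T] S]|%:R <=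
    #|T|.+1%:R * 'C(#|T|, k)%:R * c ^+ #|T|.
Proof.
move=> p f_inj kn c01 pc; have n0 : 0 < #|T|%:R :> R by rewrite ltr0n; lia.
have p01 : 0 <= p <= 1.
  by rewrite divr_ge0 //= ler_pdivrMr // mul1r ler_nat ltnW.
set N := _%:R; set w := p ^+ k * (1 - p) ^+ (#|T| - k).
have Nw : N * w <= c ^+ #|T|.
  rewrite -cardsT; apply: le_trans (bernoulli_Pr_contains_no_edge R T p p01 f c _ f_inj c01 pc).
  exact: card_bernoulli_Pr.
have w1 := binomial_mode_ge R #|T| k kn; rewrite -/p -/w in w1.
(* Multiplying [N] by a quantity that is at least one brings in [w] without dividing by it. *)
apply: (@le_trans _ _ (N * (#|T|.+1%:R * 'C(#|T|, k)%:R * w))).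
  by rewrite ler_peMr.
by rewrite mulrCA ler_wpM2l // mulr_ge0.
Qed.

Lemma uniform_Pr_diameter_neq2 (R : realType) (gT : finGroupType) (k : nat) (c : R) :
  let n := #|gT| in let p : R := k%:R / n%:R in
  (0 < k)%N -> (2 * k < n)%N -> 0 <= c <= 1 -> 1 - p ^+ 2 <= c ^+ 3 ->
  uniform_Pr R (connection_sets gT k)
    (fun S : {set gT} => diameter (Cay S) != Some 2%N)
  <= (n * (2 * n.+1))%:R * c ^+ n.
Proof.
move=> n p k0 kn c01 pc; have /andP [c0 _] := c01.
have card_conn : #|connection_sets gT k| = 'C(n.-1, k).
  by rewrite cards_draws cardsC1.
(* From [(n - k) * 'C(n, k) = n * 'C(n.-1, k)] and [2 * k < n]. *)
have binom2 : ('C(n, k) <= 2 * 'C(n.-1, k))%N.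
  have := mul_bin_down n k; have : (0 < n - k)%N by lia.
  by rewrite -/n => nk0 e; rewrite -(leq_pmul2l nk0) -e; nia.
have conn0 : (0 < 'C(n.-1, k))%N by rewrite bin_gt0; lia.
(* [A x] collects the sets, possibly containing [1], for which [x] is not a product of two
   members. *)
pose A (x : gT) := [set S : {set gT} |
  (#|S| == k) && contains_no_edge gT (fun s => (s^-1 * x)%g) [set: gT] S].
have cardA x : #|A x|%:R <= n.+1%:R * 'C(n, k)%:R * c ^+ n.
  apply: card_contains_no_edge => //; last by rewrite -/n; lia.
  by move=> s t /mulIg /invg_inj.
rewrite /uniform_Pr card_conn ler_pdivrMr ?ltr0n //.
apply: (@le_trans _ _ (\sum_(x : gT) #|A x|%:R)).
  rewrite -natr_sum ler_nat.
  apply: leq_trans (_ : #|\bigcup_x A x| <= _)%N; last first.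
    elim/big_ind2: _ => [|m1 X1 m2 X2 le1 le2|//]; first by rewrite cards0.
    by rewrite (leq_trans (leq_card_setU _ _)) // leq_add.
  apply/subset_leq_card/fintype.subsetP => S; rewrite !inE.
  case/andP => /andP [S1 /eqP cardS] diam.
  have [/forallP noA|] := boolP [forall x, S \notin A x].
    case/eqP: diam; apply: diameter_Cay_eq2 => [||x].
    - by apply/negP => /(fintype.subsetP S1); rewrite !inE eqxx.
    - by rewrite cardS; lia.
    have := noA x; rewrite inE cardS eqxx /= negb_forall => /existsP [s].
    by rewrite inE /= negbK => sS; exists s.
  rewrite negb_forall => /existsP [x]; rewrite negbK => SA.
  by apply/finset.bigcupP; exists x.
apply: (@le_trans _ _ (\sum_(x : gT) n.+1%:R * 'C(n, k)%:R * c ^+ n)).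
  by apply: ler_sum => x _; exact: cardA.
rewrite sumr_const -/n -[leLHS]mulr_natl !mulrA [leRHS]mulrAC ler_wpM2r ?exprn_ge0 //.
by rewrite -!natrM ler_nat; nia.
Qed.

(** * Constants uniform over the compact set *)

Local Open Scope classical_set_scope.

(** A compact set is closed, so missing [a] it misses a ball around [a], whose radius serves as
    [e]. *)
Lemma compact_itv_oo_bounded_below (R : realType) (K : set R) (a b : R) :
  compact K -> K `<=` `]a, b[ -> exists2 e, 0 < e & forall x, K x -> a + e <= x.
Proof.
move=> cK Kab; have : nbhs a (~` K).
  apply: open_nbhs_nbhs; split; first by apply: closed_openC; apply: compact_closed => //; exact: norm_hausdorff.
  by move=> /Kab; rewrite /= in_itv /= ltxx.
case/nbhs_ballP => e /= e0 eK; exists e => // x Kx; rewrite leNgt; apply/negP => xe.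
have ax : a < x by move/Kab: Kx; rewrite /= in_itv /= => /andP [].
by apply: (eK x) => //; rewrite /ball /= distrC ger0_norm; lra.
Qed.

(** Square [1 + x / 2 <= expR (x / 2)]. This absorbs the polynomial factor of the union bound. *)
Lemma sqr_le_expR (R : realType) (x : R) : 0 <= x -> x ^+ 2 <= 4 * expR x.
Proof.
move=> x0; have -> : x = x / 2 + x / 2 by lra.
rewrite expRD; have := expR_ge1Dx (x / 2); nra.
Qed.

Theorem theorem4p6 (R : realType) (K : set R)
    (K_compact : compact K) (K_sub : K `<=` `]0, 2^-1[) :
  exists C delta : R, 0 < C /\ 0 < delta /\
    forall (n k : nat), (0 < n)%N -> (0 < k)%N -> K (k%:R / n%:R) ->
    forall gT : finGroupType, #|gT| = n ->
      uniform_Pr R (connection_sets gT k)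
        (fun S : {set gT} => diameter (Cay S) != Some 2%N)
      <= C * expR (- (delta * n%:R)).
Proof.
have [a a0 Ka] := compact_itv_oo_bounded_below R K 0 _ K_compact K_sub.
(* With [c = expR (- (2 * d))], the choice of [d] gives [c ^+ 3 = expR (- a ^+ 2) >= 1 - a ^+ 2].
   Half of the exponent is the final rate; the other half absorbs [2 * n * n.+1 <= 4 * n ^ 2],
   whence [16 / d ^+ 2]. *)
pose d := a ^+ 2 / 6; have d0 : 0 < d by rewrite divr_gt0 ?exprn_gt0.
exists (16 / d ^+ 2), d; split; first by rewrite divr_gt0 ?exprn_gt0.
split=> // n k n0 k0 Kp gT gTn.
have nR : 0 < n%:R :> R by rewrite ltr0n.
have ap : a <= k%:R / n%:R by rewrite -[a]add0r; exact: Ka.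
have kn : (2 * k < n)%N.
  move/K_sub: Kp; rewrite /= in_itv /= => /andP [_]; rewrite ltr_pdivrMr // => kn.
  by rewrite -(ltr_nat R) natrM; lra.
have c01 : 0 <= expR (- (2 * d)) <= 1 by rewrite expR_ge0 expR_le1; lra.
have c3 : 1 - (k%:R / n%:R) ^+ 2 <= expR (- (2 * d)) ^+ 3.
  rewrite -expRM_natl; have := expR_ge1Dx (3%:R * (- (2 * d))).
  by apply: le_trans; rewrite /d; nra.
rewrite -gTn in kn nR c3 *.
apply: le_trans (uniform_Pr_diameter_neq2 R gT k _ k0 kn c01 c3) _.
rewrite -expRM_natl; set m := #|gT|%:R.
have -> : m * - (2 * d) = - (d * m) + - (d * m) by ring.
rewrite expRD mulrA ler_wpM2r ?expR_ge0 //.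
rewrite expRN ler_pdivrMr ?expR_gt0 // mulrAC ler_pdivlMr ?exprn_gt0 //.
have := sqr_le_expR R (d * m) (mulr_ge0 (ltW d0) (ltW nR)).
rewrite exprMn => le4.
have : (#|gT| * (2 * #|gT|.+1))%:R <= 4 * m ^+ 2.
  by rewrite -natrX -natrM ler_nat; move: n0; rewrite -gTn; nia.
have := sqr_ge0 d; nra.
Qed.
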